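(* Let $G$ be an $n$-vertex symmetric directed graph, let $\bowtie$ be a balanced equivalence relation on the vertices of $G$, and let $Q=G/\bowtie$ be the associated quotient graph, with $m$ vertices, where $m<n$. Then $Q$ is symmetric if and only if, for each pair of connected vertices of $Q$, the corresponding $\bowtie$-classes on the set of vertices of $G$ have the same cardinality.
   Context: Directed graphs are finite and may have loops and multiple edges. The adjacency matrix of a directed graph with vertices $1,\ldots,n$ is the $n\times n$ matrix of non-negative integers whose $(i,j)$ entry is the number of directed edges from vertex $j$ to vertex $i$. A directed graph is symmetric (bidirected) if its adjacency matrix is symmetric. An equivalence relation $\bowtie$ on the vertex set of a directed graph $G$ is balanced if, for any two vertices $u,v$ in the same $\bowtie$-class and any $\bowtie$-class $C$, the number of directed edges from vertices of $C$ to $u$ equals the number of directed edges from vertices of $C$ to $v$. For a balanced $\bowtie$ with classes $I_1,\ldots,I_m$, the quotient graph $G/\bowtie$ has one vertex for each class, and its edges are the projections of the edges of $G$: its adjacency matrix $[q_{ij}]_{m\times m}$ is given by letting $q_{ij}$ be the number of directed edges of $G$ from vertices of $I_j$ to any given vertex of $I_i$ (well defined since $\bowtie$ is balanced). A pair of vertices $i,j$ of $Q$ is called connected if there is an edge of $Q$ between them, i.e. $q_{ij}\neq 0$ or $q_{ji}\neq 0$ (when $G$ is symmetric, these two conditions are equivalent). *)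

(* Defs.v *)
From HB Require Import structures.
From mathcomp Require Import all_boot all_algebra.

Set Implicit Arguments.
Unset Strict Implicit.
Unset Printing Implicit Defensive.

Record digraph (n : nat) := Digraph {
  edge : finType;
  src : edge -> 'I_n;
  tgt : edge -> 'I_n }.

(* Entry (i, j) counts the edges from j to i. *)
Definition adjmx (n : nat) (G : digraph n) : 'M[nat]_n :=
  \matrix_(i, j) #|[set a : edge G | (src a == j) && (tgt a == i)]|.

Definition symmetric_digraph (n : nat) (G : digraph n) : Prop :=
  (adjmx G)^T%R = adjmx G.

Definition connected_vertices (n : nat) (G : digraph n) (i j : 'I_n) : bool :=
  (adjmx G i j != 0) || (adjmx G j i != 0).

Definition edges_from (n : nat) (G : digraph n) (C : {set 'I_n}) (u : 'I_n) :
    nat :=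
  #|[set a : edge G | (src a \in C) && (tgt a == u)]|.

Definition eqclasses (n : nat) (r : rel 'I_n) : {set {set 'I_n}} :=
  equivalence_partition r [set: 'I_n].

Definition balanced (n : nat) (G : digraph n) (r : rel 'I_n) : Prop :=
  forall (u v : 'I_n) (C : {set 'I_n}),
    r u v -> C \in eqclasses r -> edges_from G C u = edges_from G C v.

Definition class_at (n : nat) (r : rel 'I_n) (i : 'I_#|eqclasses r|) :
    {set 'I_n} :=
  enum_val i.

Definition class_idx (n : nat) (r : rel 'I_n) (u : 'I_n) : 'I_#|eqclasses r| :=
  let C := [set v in [set: 'I_n] | r u v] in
  enum_rank_in (imset_f _ (in_setT u) : C \in eqclasses r) C.

(* The edges of the quotient are the projections of the edges of G that end
   at a chosen representative of some class; adjmx_quotient shows that, for a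
   balanced equivalence, the edge counts do not depend on this choice. *)
Definition quotient_graph (n : nat) (G : digraph n) (r : rel 'I_n) :
    digraph #|eqclasses r| :=
  @Digraph #|eqclasses r|
    {a : edge G | tgt a \in transversal (eqclasses r) [set: 'I_n]}
    (fun a => class_idx r (src (val a)))
    (fun a => class_idx r (tgt (val a))).

Lemma eqclasses_partition (n : nat) (r : rel 'I_n) :
  equivalence_rel r -> partition (eqclasses r) [set: 'I_n].
Proof. by move=> er; apply: equivalence_partitionP => x y z _ _ _; apply: er. Qed.

Lemma class_idxK (n : nat) (r : rel 'I_n) (u : 'I_n) :
  class_at (class_idx r u) = [set v | r u v].
Proof.
rewrite /class_at /class_idx enum_rankK_in; last exact: imset_f.
by apply/setP=> v; rewrite !inE.
Qed.

Lemma mem_class_at (n : nat) (r : rel 'I_n) (u : 'I_n) (i : 'I_#|eqclasses r|) :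
  equivalence_rel r -> (u \in class_at i) = (class_idx r u == i).
Proof.
move=> er; have : class_at i \in eqclasses r by exact: enum_valP.
case/imsetP=> w _ Ei.
have {}Ei : class_at i = [set v | r w v].
  by rewrite Ei; apply/setP=> v; rewrite !inE.
apply/idP/eqP => [|<-]; last by rewrite class_idxK inE (er u u u).1.
rewrite Ei inE => wu; apply: enum_val_inj.
rewrite -![enum_val _]/(class_at _) class_idxK Ei.
by apply/setP=> v; rewrite !inE ((er w u v).2 wu).
Qed.

Lemma adjmx_quotient (n : nat) (G : digraph n) (r : rel 'I_n)
    (i j : 'I_#|eqclasses r|) (u : 'I_n) :
  equivalence_rel r -> balanced G r -> u \in class_at i ->
  adjmx (quotient_graph G r) i j = edges_from G (class_at j) u.
Proof.
move=> er bal ui; have pP := eqclasses_partition er.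
set X := transversal (eqclasses r) [set: 'I_n].
have /and3P[_ _ /forall_inP tX] : is_transversal X (eqclasses r) [set: 'I_n].
  exact: transversalP.
have iP : class_at i \in eqclasses r by exact: enum_valP.
have /cards1P[t Et] := tX _ iP.
have /setIP[tX' ti] : t \in X :&: class_at i by rewrite Et inE.
have rut : r u t.
  move: ui; rewrite mem_class_at // => /eqP ui.
  by move: ti; rewrite -ui class_idxK inE.
rewrite (bal _ _ _ rut (enum_valP j)) mxE /edges_from.
rewrite -(card_imset _ (@val_inj _ _ (edge (quotient_graph G r)))).
apply: eq_card => a; rewrite inE.
apply/imsetP/andP => [[b] | [aj /eqP at_]].
  rewrite inE /= => /andP[sj ti'] ->; rewrite mem_class_at //; split=> //.
  have : tgt (val b) \in X :&: class_at i.
    by rewrite inE (valP b) mem_class_at.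
  by rewrite Et inE.
have aX : tgt a \in X by rewrite at_.
exists (exist _ a aX) => //.
by rewrite inE /= at_ -!mem_class_at // aj ti.
Qed.

(* Main.v *)
(** Double counting the edges between two classes, with the symmetry of [G],
    gives [|I_i| q_ij = |I_j| q_ji]; both implications follow by cancellation. *)
Require Import Defs.
From mathcomp Require Import all_boot all_algebra.

(** Symmetry of [G] gives as many edges from [I_j] to [I_i] as back, which is the identity of
    [card_class_mul_quotientC]. If the quotient is symmetric, a nonzero [q_ij = q_ji] cancels and
    leaves equal class sizes. Conversely, for connected classes the common size cancels, being
    positive, and for unconnected ones both entries are 0. *)

Lemma edges_fromE (n : nat) (G : digraph n) (C : {set 'I_n}) (u : 'I_n) :
  edges_from G C u = \sum_(v in C) adjmx G u v.
Proof.
rewrite /edges_from -sum1_card (partition_big (@src n G) [in C]) /=; last first.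
  by move=> a; rewrite inE => /andP[].
apply: eq_bigr => v vC; rewrite mxE -sum1_card; apply: eq_bigl => a.
by rewrite !inE; case: (src a =P v) => [->|_]; rewrite ?vC ?andbT ?andbF.
Qed.

Lemma card_class_at_gt0 (n : nat) (r : rel 'I_n) (i : 'I_#|eqclasses r|) :
  equivalence_rel r -> 0 < #|class_at i|.
Proof.
move=> er; have /and3P[_ _ no0] := eqclasses_partition er.
rewrite card_gt0; apply: contraNneq no0 => <-; exact: enum_valP.
Qed.

(** By balance each vertex of class [i] receives the same number of edges from class [j], so both
    sides count all edges from class [j] to class [i]. *)
Lemma card_class_mul_quotient (n : nat) (G : digraph n) (r : rel 'I_n)
    (i j : 'I_#|eqclasses r|) :
  equivalence_rel r -> balanced G r ->
  #|class_at i| * adjmx (quotient_graph G r) i j =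
  \sum_(u in class_at i) \sum_(v in class_at j) adjmx G u v.
Proof.
move=> er bal; rewrite -sum_nat_const; apply: eq_bigr => u ui.
by rewrite (adjmx_quotient j er bal ui) edges_fromE.
Qed.

Lemma card_class_mul_quotientC (n : nat) (G : digraph n) (r : rel 'I_n)
    (i j : 'I_#|eqclasses r|) :
  symmetric_digraph G -> equivalence_rel r -> balanced G r ->
  #|class_at i| * adjmx (quotient_graph G r) i j =
  #|class_at j| * adjmx (quotient_graph G r) j i.
Proof.
move=> symG er bal; rewrite !card_class_mul_quotient // exchange_big /=.
by apply: eq_bigr => v _; apply: eq_bigr => u _; rewrite -[in LHS]symG mxE.
Qed.

Theorem theorem2p6 (n : nat) (G : digraph n) (r : rel 'I_n) :
  symmetric_digraph G ->
  equivalence_rel r ->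
  balanced G r ->
  #|eqclasses r| < n ->
  (symmetric_digraph (quotient_graph G r) <->
   forall i j : 'I_#|eqclasses r|,
     connected_vertices (quotient_graph G r) i j ->
     #|class_at i| = #|class_at j|).
Proof.
move=> symG er bal _; split=> [symQ i j conn | eq_card].
  have qC : adjmx (quotient_graph G r) i j = adjmx (quotient_graph G r) j i.
    by rewrite -[in LHS]symQ mxE.
  have := card_class_mul_quotientC _ G _ i j symG er bal.
  (* By [qC] the two disjuncts of connectedness coincide, so the factor to cancel is positive. *)
  move: conn; rewrite /connected_vertices qC orbb -lt0n => q_gt0 /eqP.
  by rewrite eqn_pmul2r // => /eqP.
apply/matrixP => i j; rewrite mxE.
have := card_class_mul_quotientC _ G _ i j symG er bal.
have [/eq_card -> /eqP | ] := boolP (connected_vertices (quotient_graph G r) i j).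
  by rewrite eqn_pmul2l ?card_class_at_gt0 // => /eqP.
by rewrite negb_or !negbK => /andP[/eqP -> /eqP ->].
Qed.
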